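(* Let $R$ be a Noetherian Cohen-Macaulay ring, let $j\ge 2$ be an integer, and let $I\subset R$ be an ideal such that $\mathrm{grade}\,I=j$ and $\mu(IR_P)=j$ for every $P\in V(I)$. Then $\mathrm{Fitt}_{j-1}(I)=I$.
   Context: For a finitely generated module $M$ over a Noetherian ring $R$, choose a finite free presentation $G\to F\to M\to 0$ with $\mathrm{rank}\,F=r$, and let $A$ be a matrix representing $G\to F$. The $j$th Fitting ideal of $M$ is $\mathrm{Fitt}_j(M)=I_{r-j}(A)$, where $I_t(A)$ is the ideal generated by the $t$-minors of $A$, with $I_t(A)=R$ for $t\le 0$. This is independent of the choices. An ideal $I$ is regarded as an $R$-module. $\mathrm{grade}\,I$ is the length of a maximal $R$-regular sequence contained in $I$. $V(I)$ is the set of prime ideals of $R$ containing $I$, and $\mu(IR_P)$ is the minimal number of generators of $IR_P$ over the local ring $R_P$. *)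

(* Defs.v *)
From HB Require Import structures.
From mathcomp Require Import all_boot all_algebra.
From mathcomp Require Import ring_quotient generic_quotient boolp classical_sets.
From mathcomp Require Import ring.

Set Implicit Arguments.
Unset Strict Implicit.
Unset Printing Implicit Defensive.

Import GRing.Theory.
Local Open Scope ring_scope.
Local Open Scope quotient_scope.
Local Open Scope classical_set_scope.

(* Possibly improper ideals; [idealr R] and [prime_idealr R] of ring_quotient
   exclude the unit ideal.  Classically a boolean predicate is no restriction. *)
Notation ideal R := (submodClosed R^o).

Section Ideals.
Variable R : comNzRingType.

Definition ideal_gen (S : set R) : {pred R^o} :=
  fun x => `[< forall J : ideal R, S `<=` [set y | y \in J] -> x \in J >].

Lemma ideal_gen_submod_closed S : submod_closed (ideal_gen S).
Proof.
split=> [|a x y /asboolP Sx /asboolP Sy]; apply/asboolP => J SJ.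
  exact: rpred0.
by apply: rpredD; [apply: rpredZ; apply: Sx | apply: Sy].
Qed.

HB.instance Definition _ S :=
  GRing.isSubmodClosed.Build R R^o (ideal_gen S) (ideal_gen_submod_closed S).

Definition noetherian : Prop :=
  forall I : ideal R, exists s : seq R, I =i ideal_gen [set` s].

Definition maximal_ideal (m : prime_idealr R) : Prop :=
  forall J : idealr R, {subset m <= J} -> {subset J <= m}.

Definition regular_seq (s : seq R) : Prop :=
  1 \notin ideal_gen [set` s] /\
  forall i, (i < size s)%N -> forall x : R,
    s`_i * x \in ideal_gen [set` take i s] -> x \in ideal_gen [set` take i s].

(* [n] is the length of a regular sequence in [I] that cannot be prolonged
   inside [I]. *)
Definition has_grade (I : {pred R}) (n : nat) : Prop :=
  exists s : seq R,
    [/\ size s = n, {subset s <= I}, regular_seq s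
      & forall x, x \in I -> ~ regular_seq (rcons s x)].

Definition has_mu (I : {pred R}) (n : nat) : Prop :=
  (exists2 s : seq R, size s = n & I =i ideal_gen [set` s]) /\
  (forall s : seq R, I =i ideal_gen [set` s] -> (n <= size s)%N).

Definition prime_chain (n : nat) (Q : 'I_n.+1 -> prime_idealr R) : Prop :=
  forall i j : 'I_n.+1, (i < j)%N ->
    {subset Q i <= Q j} /\ ~ {subset Q j <= Q i}.

Definition has_krull_dim (d : nat) : Prop :=
  (exists Q : 'I_d.+1 -> prime_idealr R, prime_chain Q) /\
  (forall n (Q : 'I_n.+1 -> prime_idealr R), prime_chain Q -> (n <= d)%N).

(* A local ring with depth equal to dimension; the depth of a local ring is the
   grade of its maximal ideal. *)
Definition cohen_macaulay_local : Prop :=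
  exists m : prime_idealr R,
    [/\ maximal_ideal m,
        forall n : prime_idealr R, maximal_ideal n -> n =i m
      & exists2 d, has_grade m d & has_krull_dim d].

End Ideals.

Module Localization.
Section Localization.
Variables (R : comNzRingType) (P : prime_idealr R).

Definition frac := (R * {x : R | x \notin P})%type.

Implicit Types x y z : frac.
Local Notation "'\n' x" := (x.1) (at level 8, x at level 2).
Local Notation "'\d' x" := (sval x.2) (at level 8, x at level 2).

Lemma one_notin : 1 \notin P. Proof. by rewrite idealr1. Qed.
Lemma mul_notin (s t : R) : s \notin P -> t \notin P -> s * t \notin P.
Proof. by move=> sP tP; rewrite prime_idealrM negb_or sP. Qed.

Definition equivf x y : bool :=
  `[< exists2 t, t \notin P & t * (\n x * \d y - \n y * \d x) = 0 >].

Lemma equivf_refl : reflexive equivf.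
Proof.
by move=> x; apply/asboolP; exists 1; rewrite ?one_notin // subrr mulr0.
Qed.

Lemma equivf_sym : symmetric equivf.
Proof.
by move=> x y; apply/asboolP/asboolP => -[t tP e]; exists t => //;
  rewrite -opprB mulrN e oppr0.
Qed.

Lemma equivf_trans : transitive equivf.
Proof.
move=> y x z /asboolP[t tP e] /asboolP[u uP f]; apply/asboolP.
exists (t * u * \d y); first by rewrite !mul_notin // (svalP y.2).
transitivity (u * \d z * (t * (\n x * \d y - \n y * \d x))
            + t * \d x * (u * (\n y * \d z - \n z * \d y))); first by ring.
by rewrite e f !mulr0 addr0.
Qed.

Canonical equivf_equiv := EquivRel equivf equivf_refl equivf_sym equivf_trans.

Definition type := {eq_quot equivf}.
HB.instance Definition _ : EqQuotient _ equivf type := EqQuotient.on type.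
HB.instance Definition _ := Choice.on type.

Definition mkfrac (a s : R) (sP : s \notin P) : frac := (a, exist _ s sP).

Definition addf x y : frac :=
  mkfrac (\n x * \d y + \n y * \d x) (mul_notin (svalP x.2) (svalP y.2)).
Definition oppf x : frac := (- \n x, x.2).
Definition mulf x y : frac :=
  mkfrac (\n x * \n y) (mul_notin (svalP x.2) (svalP y.2)).

Lemma pi_eqP x y :
  (exists2 t, t \notin P & t * (\n x * \d y - \n y * \d x) = 0) <->
  \pi_type x = \pi_type y.
Proof. by split=> [h|/eqmodP/asboolP//]; apply/eqmodP/asboolP. Qed.

Lemma pi_eq1 x y : \n x * \d y = \n y * \d x -> \pi_type x = \pi_type y.
Proof.
by move=> e; apply/pi_eqP; exists 1; rewrite ?one_notin // e subrr mulr0.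
Qed.

Lemma reprP x :
  exists2 t, t \notin P & t * (\n (repr (\pi_type x)) * \d x
                            - \n x * \d (repr (\pi_type x))) = 0.
Proof. by apply/pi_eqP; rewrite reprK. Qed.

Definition add := lift_op2 type addf.
Lemma pi_add : {morph \pi : x y / addf x y >-> add x y}.
Proof.
move=> x y; unlock add; apply/esym/pi_eqP.
have [t tP et] := reprP x; have [u uP eu] := reprP y.
move: et eu; set x' := repr _; set y' := repr _ => et eu.
exists (t * u); rewrite ?mul_notin //=.
transitivity (u * \d y * \d y' * (t * (\n x' * \d x - \n x * \d x'))
            + t * \d x * \d x' * (u * (\n y' * \d y - \n y * \d y'))).
  by ring.
by rewrite et eu !mulr0 addr0.
Qed.
Canonical pi_add_morph := PiMorph2 pi_add.

Definition opp := lift_op1 type oppf.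
Lemma pi_opp : {morph \pi : x / oppf x >-> opp x}.
Proof.
move=> x; unlock opp; apply/esym/pi_eqP.
have [t tP et] := reprP x; exists t => //=.
by rewrite !mulNr -opprD mulrN et oppr0.
Qed.
Canonical pi_opp_morph := PiMorph1 pi_opp.

Definition mul := lift_op2 type mulf.
Lemma pi_mul : {morph \pi : x y / mulf x y >-> mul x y}.
Proof.
move=> x y; unlock mul; apply/esym/pi_eqP.
have [t tP et] := reprP x; have [u uP eu] := reprP y.
move: et eu; set x' := repr _; set y' := repr _ => et eu.
exists (t * u); rewrite ?mul_notin //=.
transitivity (u * \n y' * \d y * (t * (\n x' * \d x - \n x * \d x'))
            + t * \n x * \d x' * (u * (\n y' * \d y - \n y * \d y'))).
  by ring.
by rewrite et eu !mulr0 addr0.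
Qed.
Canonical pi_mul_morph := PiMorph2 pi_mul.

Definition tofrac := lift_embed type (fun a : R => mkfrac a one_notin).
Canonical tofrac_pi_morph := PiEmbed tofrac.
Local Notation "x %:F" := (tofrac x).

Lemma addA : associative add.
Proof.
elim/quotW=> x; elim/quotW=> y; elim/quotW=> z; rewrite !piE.
by apply: pi_eq1 => /=; ring.
Qed.

Lemma addC : commutative add.
Proof.
by elim/quotW=> x; elim/quotW=> y; rewrite !piE; apply: pi_eq1 => /=; ring.
Qed.

Lemma add0l : left_id 0%:F add.
Proof. by elim/quotW=> x; rewrite !piE; apply: pi_eq1 => /=; ring. Qed.

Lemma addNl : left_inverse 0%:F opp add.
Proof. by elim/quotW=> x; rewrite !piE; apply: pi_eq1 => /=; ring. Qed.

HB.instance Definition _ := GRing.isZmodule.Build type addA addC add0l addNl.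

Lemma mulA : associative mul.
Proof.
elim/quotW=> x; elim/quotW=> y; elim/quotW=> z; rewrite !piE.
by apply: pi_eq1 => /=; ring.
Qed.

Lemma mulC : commutative mul.
Proof.
by elim/quotW=> x; elim/quotW=> y; rewrite !piE; apply: pi_eq1 => /=; ring.
Qed.

Lemma mul1l : left_id 1%:F mul.
Proof. by elim/quotW=> x; rewrite !piE; apply: pi_eq1 => /=; ring. Qed.

Lemma mulDl : left_distributive mul add.
Proof.
elim/quotW=> x; elim/quotW=> y; elim/quotW=> z; rewrite !piE.
by apply: pi_eq1 => /=; ring.
Qed.

Lemma one_neq0 : 1%:F != 0%:F :> type.
Proof.
rewrite !piE; apply/negP => /asboolP[t tP] /=.
by rewrite mul0r subr0 !mulr1 => t0; rewrite t0 idealr0 in tP.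
Qed.

HB.instance Definition _ :=
  GRing.Zmodule_isComNzRing.Build type mulA mulC mul1l mulDl one_neq0.

Lemma tofrac_zmod : zmod_morphism tofrac.
Proof.
move=> a b; unlock tofrac.
by rewrite -[X in _ = _ + X]pi_opp -[RHS]pi_add; apply: pi_eq1 => /=; ring.
Qed.

Lemma tofrac_monoid : monoid_morphism tofrac.
Proof.
split=> [//|a b]; unlock tofrac.
by rewrite -[RHS]pi_mul; apply: pi_eq1 => /=; ring.
Qed.

HB.instance Definition _ := GRing.isZmodMorphism.Build R type tofrac tofrac_zmod.
HB.instance Definition _ :=
  GRing.isMonoidMorphism.Build R type tofrac tofrac_monoid.

End Localization.
End Localization.
HB.export Localization.

Notation localization P := (Localization.type P).
Notation to_loc P := (@Localization.tofrac _ P).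

Definition ideal_loc (R : comNzRingType) (P : prime_idealr R) (I : ideal R) :
    {pred localization P} :=
  ideal_gen [set to_loc P x | x in [set x | x \in I]].
Arguments ideal_loc {R} P I _ : rename.

Definition cohen_macaulay (R : comNzRingType) : Prop :=
  forall m : prime_idealr R,
    maximal_ideal m -> cohen_macaulay_local (localization m).

Section IdealModule.
Variables (R : comNzRingType) (I : ideal R).

Definition ideal_module := {x : R^o | x \in I}.

HB.instance Definition _ := SubChoice.on ideal_module.
HB.instance Definition _ := [SubChoice_isSubLmodule of ideal_module by <:].

End IdealModule.

Section Fitting.
Variable R : comNzRingType.

Definition minor_ideal m n (t : nat) (A : 'M[R]_(m, n)) : {pred R} :=
  ideal_gen [set d | exists (f : 'I_t -> 'I_m) (g : 'I_t -> 'I_n),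
    [/\ {homo f : i j / (i < j)%N}, {homo g : i j / (i < j)%N}
      & d = \det (mxsub f g A)]].

(* Row-vector convention: the presentation is R^s -> R^r -> M -> 0, where the
   first arrow is [v |-> v *m A]; the rows of [A] are the relations. *)
Record presentation (M : lmodType R) := Presentation {
  pres_rank : nat;
  pres_nrel : nat;
  pres_mx : 'M[R]_(pres_nrel, pres_rank);
  pres_map : {linear 'rV[R]_pres_rank -> M};
  pres_surj : forall x, exists u, pres_map u = x;
  pres_exact : forall u, pres_map u = 0 <-> exists v, u = v *m pres_mx
}.

(* The presentation is picked by classical choice; [pred0] is a dummy value for
   modules that are not finitely presented.  When [pres_rank] is at most [j]
   the truncated difference is 0, and the only 0-minor is 1, so that one gets
   the unit ideal. *)
Definition fitting (j : nat) (M : lmodType R) : {pred R} :=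
  if pselect (inhabited (presentation M)) is left h then
    let p := inhabited_witness h in
    minor_ideal (pres_rank p - j) (pres_mx p)
  else pred0.

End Fitting.

(* Main.v *)
Require Import Defs.
From mathcomp Require Import all_boot all_algebra ring_quotient.
From HB Require Import structures.
From mathcomp Require Import perm boolp classical_sets ring.

Set Implicit Arguments.
Unset Strict Implicit.
Unset Printing Implicit Defensive.

Import GRing.Theory.
Local Open Scope ring_scope.
Local Open Scope classical_set_scope.

(** Membership in an ideal can be tested after localizing at every prime
    (mem_ideal_local), so fix a prime P and write I_P, R_P for the
    localizations.  Let g_1, ..., g_r be the generators of I given by a
    presentation, and A its matrix of relations; localization is exact, so over
    R_P the rows of A still generate all relations between the g_y.  Among the
    g_y pick a subset (g_y : y in D) that is minimal among the generating
    subsets of I_P.  As R_P is local, a minimal generating family is at most as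
    long as any other one (minimal_generators_card).

    If P contains I, then #|D| = j and r - (j - 1) = #|~: D| + 1.  Every g_y with
    y outside D is a combination of the g_y in D; these expressions are the rows
    of a matrix T of relations, with an identity block in the columns outside D.
    The heart of the matter is that the relations between the g_y, y in D, have
    coefficients in I_P (syzygy_coefs_in_ideal): I contains a regular sequence
    of length j, it stays weakly regular in R_P, and the Koszul complex of a
    family of j elements whose ideal contains a weakly regular sequence of
    length j has no homology in positive degree; hence relations are boundaries,
    whose coefficients lie in the ideal generated by the family.

    - Fitting ideal inside I: eliminating the generators outside D, every row of
      A is, modulo I_P, a combination of the #|~: D| rows of T.  So minors of A
      of size #|~: D| + 1 vanish modulo I_P (minors_in_ideal).
    - I inside Fitting ideal: add to T a Koszul relation between g_k and g_l,
      where l is an element of D other than k, which exists because j >= 2.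
      The resulting relations have a triangular minor equal to g_k
      (generators_in_minor_ideal).

    If P does not contain I, then I_P = R_P is generated by 1, so #|D| <= 1 and,
    since j >= 2, r - (j - 1) <= #|~: D|: the identity block of T makes 1 a minor, and both
    ideals are the unit ideal.

    Noetherianity is what provides the presentation, hence a nontrivial
    Fitting ideal. *)

(** * Ideals generated by sets and families *)

Section IdealBasics.
Variable S : comNzRingType.
Implicit Types (J : ideal S) (A : set S).

Lemma ideal_mulr J a x : x \in J -> a * x \in J.
Proof. exact: (@rpredZ S S^o J a x). Qed.

Lemma ideal_add J (x y : S) : x \in J -> y \in J -> x + y \in J.
Proof. exact: (@rpredD S^o J x y). Qed.

Lemma ideal_zero J : (0 : S) \in J.
Proof. exact: (@rpred0 S^o J). Qed.

Lemma ideal_sum J (T : Type) (r : seq T) (p : pred T) (F : T -> S) :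
  (forall i, p i -> F i \in J) -> \sum_(i <- r | p i) F i \in J.
Proof. exact: (@rpred_sum S^o J). Qed.

Lemma mem_ideal_gen A x : A x -> x \in ideal_gen A.
Proof. by move=> Ax; apply/asboolP => J; apply. Qed.

Lemma ideal_gen_least A J : (forall x, A x -> x \in J) ->
  {subset ideal_gen A <= J}.
Proof. by move=> AJ x /asboolP; apply=> y /AJ. Qed.

Lemma ideal_gen_mono A B : A `<=` B -> {subset ideal_gen A <= ideal_gen B}.
Proof. by move=> AB; apply: ideal_gen_least => x /AB /mem_ideal_gen. Qed.

(** Lets a property closed under linear combinations be used where an ideal
    is expected. *)
Lemma ideal_comprehension (Q : S -> Prop) :
  Q 0 -> (forall a x y, Q x -> Q y -> Q (a * x + y)) ->
  exists J : ideal S, forall x, x \in J <-> Q x.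
Proof.
move=> Q0 QD; pose p : {pred S^o} := fun x => `[< Q x >].
have cl : submod_closed p.
  split=> [|a y z /asboolP Qy /asboolP Qz]; first exact/asboolP.
  by apply/asboolP; apply: QD.
pose J : ideal S := HB.pack p (GRing.isSubmodClosed.Build S S^o p cl).
by exists J => x; split=> /asboolP.
Qed.

Lemma ideal_gen_ind A (Q : S -> Prop) :
  Q 0 -> (forall a x y, Q x -> Q y -> Q (a * x + y)) ->
  (forall x, A x -> Q x) -> forall x, x \in ideal_gen A -> Q x.
Proof.
move=> Q0 QD AQ x; have [J JQ] := ideal_comprehension Q0 QD.
by move=> /(@ideal_gen_least A J (fun y Ay => (JQ y).2 (AQ y Ay))) /JQ.
Qed.

Lemma ideal_gen_rangeP n (g : 'I_n -> S) x :
  x \in ideal_gen (range g) <-> exists u : 'I_n -> S, x = \sum_i u i * g i.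
Proof.
split; last first.
  move=> [u ->]; apply: ideal_sum => i _.
  by apply/ideal_mulr/mem_ideal_gen; exists i.
move: x; apply: ideal_gen_ind => [|a x y [u ->] [v ->]|_ [i _ <-]].
- by exists (fun=> 0); rewrite big1 // => i _; rewrite mul0r.
- exists (fun i => a * u i + v i).
  rewrite mulr_sumr -big_split; apply: eq_bigr => i _.
  by rewrite mulrDl mulrA.
- exists (fun k => (k == i)%:R).
  rewrite (bigD1 i) //= eqxx mul1r big1 ?addr0 // => k /negPf->.
  by rewrite mul0r.
Qed.

Lemma set_seq_range (s : seq S) :
  [set` s] = range (fun i : 'I_(size s) => s`_i).
Proof.
apply/seteqP; split=> x /=.
  by move=> /(nthP 0)[i ltis <-]; exists (Ordinal ltis).
by move=> [i _ <-]; apply: mem_nth.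
Qed.

End IdealBasics.

(** * The Koszul complex *)

Section Koszul.
Variable S : comNzRingType.
Implicit Types (J : ideal S) (n p : nat).

(** The exterior algebra of the free module with basis e_0, ..., e_(n-1): in the
    recursive step, the pair (x, y) stands for x + e_n' /\ y.  The recursion
    avoids signs indexed by subsets. *)
Fixpoint ext n : lmodType S :=
  if n is n'.+1 then (ext n' * ext n')%type : lmodType S else S^o.

(** The Koszul differential: the antiderivation that sends e_i to a i. *)
Fixpoint kdiff (a : nat -> S) n : ext n -> ext n :=
  match n return ext n -> ext n with
  | 0 => fun=> 0
  | n'.+1 => fun x => (kdiff a x.1 + a n' *: x.2, - kdiff a x.2)
  end.

(** Left exterior multiplication by the vector sum_i u i * e_i. *)
Fixpoint wedge (u : nat -> S) n : ext n -> ext n :=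
  match n return ext n -> ext n with
  | 0 => fun=> 0
  | n'.+1 => fun x => (wedge u x.1, u n' *: x.1 - wedge u x.2)
  end.

Fixpoint ext_one n : ext n :=
  match n return ext n with 0 => 1 | n'.+1 => (ext_one n', 0) end.

Fixpoint coefs_in J n : ext n -> Prop :=
  match n return ext n -> Prop with
  | 0 => fun x => x \in J
  | n'.+1 => fun x => coefs_in J x.1 /\ coefs_in J x.2
  end.

(** All homogeneous components of x have degree at least p.  Working with this
    filtration instead of the grading is enough to know that an element vanishes
    as soon as p exceeds n.  The truncation in p.-1 is harmless because the
    condition is empty for p = 0. *)
Fixpoint deg_ge p n : ext n -> Prop :=
  match n return ext n -> Prop with
  | 0 => fun x => (0 < p)%N -> x = 0
  | n'.+1 => fun x => deg_ge p x.1 /\ deg_ge p.-1 x.2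
  end.

Lemma kdiff_linear a n : linear (@kdiff a n).
Proof.
move=> b x y; elim: n x y => [|n IHn] x y /=; first by rewrite scaler0 addr0.
rewrite !IHn; congr pair => /=.
  by rewrite !scalerDr !scalerA mulrC addrACA.
by rewrite opprD scalerN.
Qed.

HB.instance Definition _ a n :=
  GRing.isLinear.Build S (ext n) (ext n) *:%R (@kdiff a n) (@kdiff_linear a n).

Lemma wedge_linear u n : linear (@wedge u n).
Proof.
move=> b x y; elim: n x y => [|n IHn] x y /=; first by rewrite scaler0 addr0.
rewrite !IHn; congr pair => /=.
by rewrite !(scalerDr, scalerN) !scalerA mulrC opprD addrACA.
Qed.

HB.instance Definition _ u n :=
  GRing.isLinear.Build S (ext n) (ext n) *:%R (@wedge u n) (@wedge_linear u n).

Lemma kdiffK a n (x : ext n) : kdiff a (kdiff a x) = 0.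
Proof.
elim: n x => [|n IHn] x //=.
rewrite linearD linearZ linearN /= !IHn add0r.
by rewrite addrN linearN /= IHn !oppr0.
Qed.

(** Multiplication by an element of the ideal of the a i is homotopic to zero on
    the Koszul complex; the homotopy is the exterior multiplication by the
    coefficients of the element. *)
Lemma kdiff_wedge a u n (x : ext n) :
  kdiff a (wedge u x) + wedge u (kdiff a x) = (\sum_(i < n) u i * a i) *: x.
Proof.
elim: n x => [|n IHn] /=; first by move=> x; rewrite big_ord0 scale0r addr0.
move=> [x y] /=; rewrite big_ord_recr /=; congr pair => /=.
  rewrite [wedge u (_ + _)]linearD /= [wedge u (_ *: _)]linearZ /=.
  rewrite [RHS]scalerDl -[X in _ = X + _]IHn scalerBr scalerA [a n * _]mulrC.
  rewrite -!addrA; congr (_ + _); rewrite [RHS]addrC; congr (_ + _).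
  by rewrite addrC -addrA addrN addr0.
rewrite [kdiff a (_ - _)]linearB /= [kdiff a (_ *: _)]linearZ /=.
rewrite [wedge u (- _)]linearN /= [RHS]scalerDl -[X in _ = X + _]IHn.
rewrite scalerDr scalerA opprB opprK -!addrA; congr (_ + _).
by rewrite !addrA addNr add0r addrC.
Qed.

Lemma coefs_inD J n (x y : ext n) :
  coefs_in J x -> coefs_in J y -> coefs_in J (x + y).
Proof.
elim: n x y => [|n IHn] x y /=; first exact: ideal_add.
by move=> [? ?] [? ?]; split; apply: IHn.
Qed.

Lemma coefs_inZ J n b (x : ext n) : coefs_in J x -> coefs_in J (b *: x).
Proof.
elim: n x => [|n IHn] x /=; first exact: ideal_mulr.
by move=> [? ?]; split; apply: IHn.
Qed.

Lemma coefs_inN J n (x : ext n) : coefs_in J x -> coefs_in J (- x).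
Proof. by rewrite -scaleN1r; apply: coefs_inZ. Qed.

Lemma coefs_in_scale J n b (x : ext n) : b \in J -> coefs_in J (b *: x).
Proof.
move=> bJ; elim: n x => [|n IHn] x /=; last by split; apply: IHn.
by rewrite [_ *: _]mulrC; apply: ideal_mulr.
Qed.

Lemma coefs_in0 J n : coefs_in J (0 : ext n).
Proof. by rewrite -(scale0r 0); apply: coefs_in_scale; apply: ideal_zero. Qed.

Lemma coefs_in_sub J J' n (x : ext n) :
  {subset J <= J'} -> coefs_in J x -> coefs_in J' x.
Proof.
move=> JJ'; elim: n x => [|n IHn] x /=; first exact: JJ'.
by move=> [? ?]; split; apply: IHn.
Qed.

Lemma coefs_in_kdiff J a n (x : ext n) : coefs_in J x -> coefs_in J (kdiff a x).
Proof.
elim: n x => [|n IHn] x /=; first by move=> _; apply: ideal_zero.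
move=> [x1 x2]; split; last by apply/coefs_inN/IHn.
by apply: coefs_inD; [apply: IHn | apply: coefs_inZ].
Qed.

Lemma coefs_in_wedge J u n (x : ext n) : coefs_in J x -> coefs_in J (wedge u x).
Proof.
elim: n x => [|n IHn] x /=; first by move=> _; apply: ideal_zero.
move=> [x1 x2]; split; first exact: IHn.
by apply: coefs_inD; [apply: coefs_inZ | apply/coefs_inN/IHn].
Qed.

Lemma kdiff_coefs_in J a n (x : ext n) :
  (forall i, (i < n)%N -> a i \in J) -> coefs_in J (kdiff a x).
Proof.
elim: n x => [|n IHn] x aJ /=; first exact: ideal_zero.
have aJ' i : (i < n)%N -> a i \in J by move=> /ltnW; apply: aJ.
split; last by apply/coefs_inN/IHn.
by apply: coefs_inD; [apply: IHn | apply/coefs_in_scale/aJ].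
Qed.

Lemma wedge_one_coefs J u n :
  coefs_in J (wedge u (ext_one n)) -> forall i, (i < n)%N -> u i \in J.
Proof.
elim: n => [|n IHn] //= [u1 u2] i; rewrite ltnS leq_eqVlt.
move=> /predU1P[->|]; last exact: IHn.
have {u2} : coefs_in J (u n *: ext_one n) by move: u2; rewrite linear0 subr0.
move: (u n) => b; elim: n {IHn u1} => [|n IHn] /=; last by case=> /IHn.
by rewrite [_ *: _]mulr1.
Qed.

Lemma kdiff_one a n : kdiff a (ext_one n) = 0.
Proof.
elim: n => [|n IHn] //=.
by rewrite IHn scaler0 add0r [kdiff a 0]linear0 oppr0.
Qed.

Lemma coefs_in_split (J J' : ideal S) b n (x : ext n) :
  (forall c, c \in J' -> exists2 e, e \in J & exists c', c = b * c' + e) ->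
  coefs_in J' x ->
  exists2 z : ext n, coefs_in J z & exists y : ext n, x = b *: y + z.
Proof.
move=> J'P; elim: n x => [|n IHn] x /=; first exact: J'P.
move=> [/IHn[z1 z1J [y1 e1]] /IHn[z2 z2J [y2 e2]]].
by exists (z1, z2) => //; exists (y1, y2); rewrite [LHS]surjective_pairing e1 e2.
Qed.

Lemma coefs_in_cancel J b n (x : ext n) :
  (forall c, b * c \in J -> c \in J) -> coefs_in J (b *: x) -> coefs_in J x.
Proof.
move=> bJ; elim: n x => [|n IHn] x /=; first exact: bJ.
by move=> [/IHn ? /IHn].
Qed.

Lemma deg_geB p n (x y : ext n) : deg_ge p x -> deg_ge p y -> deg_ge p (x - y).
Proof.
elim: n p x y => [|n IHn] p x y /=.
  by move=> x0 y0 p0; rewrite x0 // y0 // subr0.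
by move=> [? ?] [? ?]; split; apply: IHn.
Qed.

Lemma deg_geZ p n b (x : ext n) : deg_ge p x -> deg_ge p (b *: x).
Proof.
elim: n p x => [|n IHn] p x /=; first by move=> x0 p0; rewrite x0 // scaler0.
by move=> [? ?]; split; apply: IHn.
Qed.

Lemma deg_ge0 n (x : ext n) : deg_ge 0 x.
Proof. by elim: n x => [|n IHn] x //=; split; apply: IHn. Qed.

Lemma deg_ge_wedge u p n (x : ext n) : deg_ge p x -> deg_ge p.+1 (wedge u x).
Proof.
elim: n p x => [|n IHn] p x //= [x1 x2]; split; first exact: IHn.
case: p x1 x2 => [|p] x1 x2; first exact: deg_ge0.
by apply: deg_geB; [apply: deg_geZ | apply: IHn].
Qed.

Lemma deg_ge_gt n p (x : ext n) : (n < p)%N -> deg_ge p x -> x = 0.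
Proof.
elim: n p x => [|n IHn] [|p] x //= ltnp; first by apply.
move=> [x1 x2]; rewrite [x]surjective_pairing (IHn _ _ _ x1) ?(IHn _ _ _ x2) //.
by rewrite ltnW.
Qed.

Definition weakly_regular (f : seq S) : Prop :=
  forall i, (i < size f)%N -> forall x : S,
    f`_i * x \in ideal_gen [set` take i f] -> x \in ideal_gen [set` take i f].

Lemma ideal_gen_take_succ (f : seq S) k c : (k < size f)%N ->
  c \in ideal_gen [set` take k.+1 f] ->
  exists2 e, e \in ideal_gen [set` take k f] & exists c', c = f`_k * c' + e.
Proof.
move=> ltk; move: c; apply: ideal_gen_ind => [|b x y [e eJ [c ->]] [e' eJ' [c' ->]]|x].
- by exists 0; [apply: ideal_zero | exists 0; rewrite mulr0 addr0].
- exists (b * e + e'); first by apply: ideal_add => //; apply: ideal_mulr.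
  by exists (b * c + c'); ring.
- rewrite (take_nth 0) //= mem_rcons inE => /predU1P[->|xf].
    by exists 0; [apply: ideal_zero | exists 1; rewrite mulr1 addr0].
  by exists x; [apply: mem_ideal_gen | exists 0; rewrite mulr0 add0r].
Qed.

(** Vanishing of the Koszul homology over the quotient by the first k terms of f,
    in degrees above k, stated with congruences modulo these terms.  The
    induction descends on k and starts at k = size f, where only zero has such
    a degree.  In the step, the homotopy of f_k turns the cycle w modulo
    f_0, ..., f_(k-1) into the cycle (U k) /\ w of higher degree modulo
    f_0, ..., f_k.  By induction the latter is a boundary modulo f_0, ..., f_k;
    applying the differential again shows that f_k * w is f_k times a boundary
    modulo f_0, ..., f_(k-1), and f_k cancels by regularity. *)
Lemma koszul_acyclic (f : seq S) (a : nat -> S) (U : nat -> nat -> S) n k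
    (w : ext n) :
  weakly_regular f ->
  (forall i, (i < size f)%N -> f`_i = \sum_(l < n) U i l * a l) ->
  (n <= size f)%N -> (k <= size f)%N -> deg_ge k.+1 w ->
  coefs_in (ideal_gen [set` take k f]) (kdiff a w) ->
  exists2 z : ext n, coefs_in (ideal_gen [set` take k f]) z
    & exists y, w = kdiff a y + z.
Proof.
move=> freg fU lenf; move em: (size f - k)%N => m.
elim: m k w em => [|m IHm] k w em lekf dw dwJ.
  exists 0; first exact: coefs_in0.
  exists 0; rewrite linear0 addr0 (deg_ge_gt _ dw) //.
  by rewrite ltnS (leq_trans lenf) // -subn_eq0 em.
have ltkf : (k < size f)%N by rewrite -subn_gt0 em.
pose J := ideal_gen [set` take k f]; pose J' := ideal_gen [set` take k.+1 f].
have JJ' : {subset J <= J'}.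
  apply: ideal_gen_mono => x /=; rewrite [take k.+1 _](take_nth 0) // mem_rcons.
  by rewrite inE => ->; rewrite orbT.
have fkJ' : f`_k \in J'.
  by apply: mem_ideal_gen; rewrite /= (take_nth 0) // mem_rcons mem_head.
have homot := kdiff_wedge a (U k) w; rewrite -fU // in homot.
have [||||z' z'J' [y ey]] := IHm k.+1 (wedge (U k) w).
- by rewrite subnS em.
- by [].
- exact: deg_ge_wedge.
- rewrite -[kdiff _ _](addrK (wedge (U k) (kdiff a w))) homot.
  apply: coefs_inD; first exact: coefs_in_scale.
  by apply/coefs_inN/coefs_in_wedge; apply: coefs_in_sub dwJ.
have [z zJ [y' ey']] := coefs_in_split (fun c => @ideal_gen_take_succ f k c ltkf) z'J'.
exists (w - kdiff a y'); last by exists y'; rewrite addrC subrK.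
apply: (coefs_in_cancel (freg k ltkf)).
have key : kdiff a (wedge (U k) w) = f`_k *: kdiff a y' + kdiff a z.
  by rewrite ey linearD /= kdiffK add0r ey' linearD /= linearZ.
rewrite scalerBr -homot key [_ + kdiff a z]addrC addrAC addrK.
by apply: coefs_inD; [apply: coefs_in_kdiff | apply: coefs_in_wedge].
Qed.

(** A relation is a cycle of degree one, so it is a boundary by koszul_acyclic,
    and boundaries have coefficients in the ideal. *)
Theorem syzygy_coefs_in_ideal n (a c : 'I_n -> S) (f : seq S) :
  weakly_regular f -> (n <= size f)%N -> {subset f <= ideal_gen (range a)} ->
  \sum_i c i * a i = 0 -> forall i, c i \in ideal_gen (range a).
Proof.
move=> freg lenf fa ca0 i.
(* The Koszul complex is indexed by natural numbers: extend by zero. *)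
pose ext0 (v : 'I_n -> S) k := oapp v 0 (insub k).
have ext0E v (k : 'I_n) : ext0 v k = v k by rewrite /ext0 valK.
have aJ k : (k < n)%N -> ext0 a k \in ideal_gen (range a).
  by move=> ltkn; rewrite (ext0E _ (Ordinal ltkn)); apply: mem_ideal_gen; eexists.
have /choice[U fU] : forall k, exists u : nat -> S,
    (k < size f)%N -> f`_k = \sum_(l < n) u l * ext0 a l.
  move=> k; have [ltk|_] := ltnP; last by exists (fun=> 0).
  have /ideal_gen_rangeP[u fku] := fa _ (mem_nth 0 ltk).
  by exists (ext0 u) => _; rewrite fku; apply: eq_bigr => l _; rewrite !ext0E.
rewrite -(ext0E c); move: i (valP i) => [i /= ltin] _; move: i ltin.
apply: wedge_one_coefs.
have cycle : kdiff (ext0 a) (wedge (ext0 c) (ext_one n)) = 0.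
  have := kdiff_wedge (ext0 a) (ext0 c) (ext_one n).
  rewrite kdiff_one [wedge _ 0]linear0 addr0 => ->.
  rewrite (eq_bigr (fun i => c i * a i)) ?ca0 ?scale0r // => k _.
  by rewrite !ext0E.
have [||z zJ [y ->]] := koszul_acyclic freg fU lenf (leq0n _)
  (w := wedge (ext0 c) (ext_one n)).
- by apply: deg_ge_wedge; apply: deg_ge0.
- by rewrite cycle; apply: coefs_in0.
apply: coefs_inD; first exact: kdiff_coefs_in.
by apply: coefs_in_sub zJ; rewrite take0; apply: ideal_gen_least.
Qed.

End Koszul.
(** * Ideals of minors *)

Section Minors.
Variable S : comNzRingType.
Implicit Types (J : ideal S).

(** Reduces minors taken along arbitrary index maps to the increasing ones that
    define the ideal of minors: list the image in increasing order. *)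
Lemma increasing_factorization t m (f : 'I_t -> 'I_m) : injective f ->
  exists f0 : 'I_t -> 'I_m, {homo f0 : i k / (i < k)%N} /\
    exists s : 'S_t, forall i, f i = f0 (s i).
Proof.
move=> finj; pose D := [set f i | i in 'I_t]%SET.
have cD : #|D| = t by rewrite card_imset // card_ord.
pose f0 (i : 'I_t) := enum_val (cast_ord (esym cD) i).
have fD i : f i \in D by apply: imset_f.
have sinj : injective (fun i => cast_ord cD (enum_rank_in (fD i) (f i))).
  move=> i k /cast_ord_inj /(congr1 enum_val).
  by rewrite !enum_rankK_in // => /finj.
exists f0; split; last first.
  by exists (perm sinj) => i; rewrite permE /f0 cast_ordK enum_rankK_in.
move=> i k ltik; rewrite /f0.
have sD : sorted ltn [seq val x | x <- enum D].
  have -> : enum D = [seq x <- enum 'I_m | x \in D].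
    by rewrite {1}/enum_mem; rewrite -enumT; apply: eq_filter.
  rewrite sorted_map; apply: sorted_filter => [x y z|]; first exact: ltn_trans.
  by rewrite -sorted_map val_enum_ord iota_ltn_sorted.
have szD : size (enum D) = t by rewrite -cardE.
rewrite !(enum_val_nth (f i)) -!(nth_map (f i) (val (f i)) val) ?szD //=.
by apply: (sorted_ltn_nth ltn_trans _ sD); rewrite ?inE ?size_map ?szD.
Qed.

Lemma minor_in_minor_ideal m n t (A : 'M[S]_(m, n))
    (f : 'I_t -> 'I_m) (g : 'I_t -> 'I_n) :
  \det (mxsub f g A) \in minor_ideal t A.
Proof.
have [/injectiveP finj|/injectivePn[i [k neik fik]]] := boolP (injectiveb f); last first.
  rewrite (determinant_alternate neik) ?ideal_zero // => l.
  by rewrite !mxE fik.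
have [/injectiveP ginj|/injectivePn[i [k neik gik]]] := boolP (injectiveb g); last first.
  rewrite -det_tr (determinant_alternate neik) ?ideal_zero // => l.
  by rewrite !mxE gik.
have [f0 [f0i [s fE]]] := increasing_factorization finj.
have [g0 [g0i [s' gE]]] := increasing_factorization ginj.
have -> : mxsub f g A = row_perm s (col_perm s' (mxsub f0 g0 A)).
  by apply/matrixP => i k; rewrite !mxE fE gE.
rewrite row_permE col_permE !det_mulmx.
apply: ideal_mulr; rewrite mulrC; apply: ideal_mulr.
by apply: mem_ideal_gen; exists f0, g0.
Qed.

(** The expansion half of the Cauchy-Binet formula: by multilinearity in the
    rows, a minor of C *m A is a combination of minors of A along arbitrary,
    possibly repeated, rows. *)
Lemma minor_mulmx_in_minor_ideal m n p t (C : 'M[S]_(p, m)) (A : 'M[S]_(m, n))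
    (f : 'I_t -> 'I_p) (g : 'I_t -> 'I_n) :
  \det (mxsub f g (C *m A)) \in minor_ideal t A.
Proof.
rewrite mxsub_mul; set C' := mxsub _ _ C; set A' := mxsub _ _ A.
pose CA s i k := C' i k * A' k (s i).
have -> : \det (C' *m A') = \sum_(h : {ffun 'I_t -> 'I_m})
    (\prod_i C' i (h i)) * \det (mxsub h g A).
  transitivity (\sum_(h : {ffun 'I_t -> 'I_m}) \sum_(s : 'S_t)
      (-1) ^+ s * \prod_i CA s i (h i)).
    rewrite exchange_big; apply: eq_bigr => /= s _; rewrite -big_distrr /=.
    congr (_ * _); rewrite -(bigA_distr_bigA (CA s)) /=.
    by apply: eq_bigr => x _; rewrite mxE.
  apply: eq_bigr => h _; rewrite mulr_sumr; apply: eq_bigr => s _.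
  rewrite mulrCA big_split //=; congr (_ * (_ * _)).
  by apply: eq_bigr => x _; rewrite !mxE.
by apply: ideal_sum => h _; apply/ideal_mulr/minor_in_minor_ideal.
Qed.

Lemma prod_congr J (T : Type) (r : seq T) (F G : T -> S) :
  (forall i, F i - G i \in J) -> \prod_(i <- r) F i - \prod_(i <- r) G i \in J.
Proof.
move=> FG; elim: r => [|i r IHr]; first by rewrite !big_nil subrr; apply: ideal_zero.
rewrite !big_cons.
have -> : forall a b c d : S, a * b - c * d = b * (a - c) + c * (b - d) by move=> *; ring.
by apply: ideal_add; apply: ideal_mulr.
Qed.

Lemma det_congr J n (A B : 'M[S]_n) :
  (forall i k, A i k - B i k \in J) -> \det A - \det B \in J.
Proof.
move=> AB; rewrite -sumrB; apply: ideal_sum => s _; rewrite -mulrBr.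
by apply/ideal_mulr/prod_congr.
Qed.

(** Pad both factors with zeros to make them square. *)
Lemma det_mulmx_small n q (A : 'M[S]_(n, q)) (B : 'M[S]_(q, n)) :
  (q < n)%N -> \det (A *m B) = 0.
Proof.
move=> ltqn; have [k enk] : exists k, n = (q + k.+1)%N.
  by exists (n - q).-1; rewrite prednK ?subn_gt0 // subnKC // ltnW.
move: A B; rewrite {ltqn}enk => A B.
have -> : A *m B = row_mx A (0 : 'M_(_, k.+1)) *m col_mx B (0 : 'M_(k.+1, _)).
  by rewrite mul_row_col mul0mx addr0.
rewrite det_mulmx (expand_det_col (row_mx _ _) (rshift q ord0)) big1 ?mul0r // => i _.
by rewrite row_mxEr mxE mul0r.
Qed.

End Minors.
(** * Localization at primes *)

Section PrimeExistence.
Variable R : comNzRingType.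

(** Zorn's lemma gives a set A maximal among those that do not generate the unit
    ideal together with K; the ideal so generated is maximal above K, hence
    prime. *)
Lemma exists_prime_above (K : ideal R) :
  1 \notin K -> exists P : prime_idealr R, {subset K <= P}.
Proof.
move=> K1; pose KU (A : set R) : set R := [set x : R | x \in K] `|` A.
have [|A [AP Amax]] := @Zorn_bigcup R [set A | 1 \notin ideal_gen (KU A)].
  move=> F FP Ftot /=; apply/negP.
  suff : forall y : R, y \in ideal_gen (KU (\bigcup_(X in F) X)) ->
      y \in K \/ exists2 X, F X & y \in ideal_gen (KU X).
    move=> /[apply] -[K1'|[X FX X1]]; first by rewrite K1' in K1.
    by have := FP X FX; rewrite /= X1.
  apply: ideal_gen_ind => [|b x y Qx Qy|x [xK|[X FX Xx]]].
  - by left; apply: ideal_zero.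
  - have Kgen X (z : R) : z \in K -> z \in ideal_gen (KU X).
      by move=> zK; apply: mem_ideal_gen; left.
    case: Qx Qy => [xK|[X FX xX]] [yK|[Y FY yY]].
    + by left; apply: ideal_add => //; apply: ideal_mulr.
    + by right; exists Y => //; apply: ideal_add => //; apply/ideal_mulr/Kgen.
    + right; exists X => //; apply: ideal_add; last exact: Kgen.
      exact: ideal_mulr.
    + right; have [XY|YX] := Ftot X Y FX FY; [exists Y | exists X] => //.
        apply: ideal_add => //; apply: ideal_mulr.
        by apply: ideal_gen_mono xX; apply: setUS.
      apply: ideal_add; first exact: ideal_mulr.
      by apply: ideal_gen_mono yY; apply: setUS.
  - by left.
  - by right; exists X => //; apply: mem_ideal_gen; right.
pose M : ideal R := ideal_gen (KU A).
have KM : {subset K <= M} by move=> x xK; apply: mem_ideal_gen; left.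
have AM x : A x -> x \in M by move=> Ax; apply: mem_ideal_gen; right.
have Mclosed : idealr_closed M.
  split; [exact: ideal_zero|exact: AP|].
  by move=> b x y xM yM; apply: ideal_add => //; apply: ideal_mulr.
have Mprime : prime_idealr_closed M.
  move=> u v uvM; have [//|uM /=] := boolP (u \in M).
  have : ~ (1 \notin ideal_gen (KU (A `|` [set u]))).
    apply: Amax; split; first exact: subsetUl.
    by move=> /(_ u) h; move: uM; rewrite AM //; apply: h; right.
  move=> /negP/negPn.
  suff : forall y : R, y \in ideal_gen (KU (A `|` [set u])) ->
      exists2 z, z \in M & exists b, y = z + b * u.
    move=> /[apply] -[z zM [b e1]].
    rewrite -[v]mul1r e1 mulrDl -mulrA; apply: ideal_add; last exact: ideal_mulr.
    by rewrite mulrC; apply: ideal_mulr.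
  apply: ideal_gen_ind => [|b x y [z zM [e ->]] [z' zM' [e' ->]]|x [xK|[Ax|->]]].
  - by exists 0; [apply: ideal_zero | exists 0; rewrite mul0r addr0].
  - exists (b * z + z'); first by apply: ideal_add => //; apply: ideal_mulr.
    by exists (b * e + e'); ring.
  - by exists x; [apply: KM | exists 0; rewrite mul0r addr0].
  - by exists x; [apply: AM | exists 0; rewrite mul0r addr0].
  - by exists 0; [apply: ideal_zero | exists 1; rewrite mul1r add0r].
pose p : {pred R} := fun x => x \in M.
pose P : prime_idealr R := HB.pack p (isIdealr.Build R p Mclosed)
  (isPrimeIdealrClosed.Build R p Mprime).
by exists P.
Qed.

End PrimeExistence.

Definition local_ring_at (S : comNzRingType) (m : ideal S) : Prop :=
  1 \notin m /\ forall x, x \notin m -> exists v, v * x = 1.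

Section LocalizedIdeals.
Variables (R : comNzRingType) (P : prime_idealr R).
Local Notation phi := (to_loc P).
Implicit Types (J : ideal R).

Lemma to_locE x :
  phi x = \pi_(localization P)%qT
            (Localization.mkfrac x (Localization.one_notin P)).
Proof. by unlock Localization.tofrac. Qed.

Lemma to_loc_eqP (x y : R) : phi x = phi y <-> exists2 t, t \notin P & t * x = t * y.
Proof.
rewrite !to_locE -Localization.pi_eqP /=; split=> -[t tP e]; exists t => //.
  by move: e; rewrite !mulr1 mulrBr => /eqP; rewrite subr_eq0 => /eqP.
by rewrite !mulr1 mulrBr e subrr.
Qed.

Lemma to_loc_inv s : s \notin P -> exists v, v * phi s = 1.
Proof.
move=> sP; exists (\pi_(localization P)%qT (Localization.mkfrac 1 sP)).
have -> : 1 = phi 1 by rewrite rmorph1.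
rewrite !to_locE -[LHS]Localization.pi_mul; apply: Localization.pi_eq1 => /=.
by ring.
Qed.

Lemma loc_fracP (y : localization P) :
  exists x s, s \notin P /\ phi s * y = phi x.
Proof.
elim/quotW: y => -[x [s sP]]; exists x, s; split=> //.
rewrite !to_locE -[LHS]Localization.pi_mul; apply: Localization.pi_eq1 => /=.
by ring.
Qed.

Lemma mul_notin_prime s t : s \notin P -> t \notin P -> s * t \notin P.
Proof. exact: Localization.mul_notin. Qed.

Lemma ideal_locP J (y : localization P) :
  y \in ideal_loc P J <->
  exists x s, [/\ x \in J, s \notin P & phi s * y = phi x].
Proof.
split; last first.
  move=> [x [s [xJ /to_loc_inv[v vs] e]]].
  rewrite -[y]mul1r -vs -mulrA e; apply: ideal_mulr.
  by apply: mem_ideal_gen; exists x.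
move: y; apply: ideal_gen_ind => [|b y z [x [s [xJ sP e]]] [x' [s' [xJ' sP' e']]]|].
- exists 0, 1; rewrite idealr1 mulr0 rmorph0; split=> //; exact: ideal_zero.
- have [c [t [tP ec]]] := loc_fracP b.
  exists (s' * c * x + s * t * x'), (s * t * s'); split.
  + by apply: ideal_add; apply: ideal_mulr.
  + by rewrite !mul_notin_prime.
  + rewrite rmorphD !rmorphM /= -e -e' -ec; ring.
- move=> _ [x xJ <-]; exists x, 1; rewrite idealr1 rmorph1 mul1r; by split.
Qed.

Lemma to_loc_in_ideal_loc J x :
  phi x \in ideal_loc P J <-> exists2 t, t \notin P & t * x \in J.
Proof.
rewrite ideal_locP; split.
  move=> [z [s [zJ sP]]]; rewrite -rmorphM => /to_loc_eqP[t tP e].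
  exists (t * s); first exact: mul_notin_prime.
  by rewrite -mulrA e; apply: ideal_mulr.
by move=> [t tP txJ]; exists (t * x), t; rewrite rmorphM.
Qed.

Lemma ideal_gen_image (A : set R) :
  ideal_gen [set phi x | x in A] =i ideal_loc P (ideal_gen A).
Proof.
move=> y; apply/idP/idP; move: y; apply: ideal_gen_least => _ [x xA <-].
  by apply: mem_ideal_gen; exists x => //; apply: mem_ideal_gen.
move: x xA; apply: ideal_gen_ind => [|b x y xJ yJ|x Ax].
- by rewrite rmorph0; apply: ideal_zero.
- by rewrite rmorphD rmorphM; apply: ideal_add => //; apply: ideal_mulr.
- by apply: mem_ideal_gen; exists x.
Qed.

Lemma ideal_gen_map (s : seq R) :
  ideal_gen [set` [seq phi x | x <- s]] =i ideal_loc P (ideal_gen [set` s]).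
Proof.
have -> : [set` [seq phi x | x <- s]] = [set phi x | x in [set` s]].
  apply/seteqP; split=> y /=; first by move=> /mapP[x xs ->]; exists x.
  by move=> [x xs <-]; apply: map_f.
exact: ideal_gen_image.
Qed.

(** Flatness of localization, by clearing denominators. *)
Lemma weakly_regular_loc (f : seq R) :
  weakly_regular f -> weakly_regular [seq phi x | x <- f].
Proof.
move=> freg i; rewrite size_map => ltif y.
rewrite (nth_map 0) // -map_take 2!ideal_gen_map.
have [x [s [sP e]]] := loc_fracP y.
move=> /(ideal_mulr (phi s)); rewrite mulrCA e -rmorphM.
move=> /to_loc_in_ideal_loc[t tP]; rewrite mulrCA => /(freg i ltif (t * x)) txJ.
apply/ideal_locP; exists (t * x), (t * s); split=> //; first exact: mul_notin_prime.
by rewrite !rmorphM /= -mulrA e.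
Qed.

Lemma prime_is_ideal : exists J : ideal R, J =i P.
Proof.
have [||J JP] := @ideal_comprehension R (fun x => x \in P).
- exact: idealr0.
- by move=> a x y xP yP; apply: rpredD => //; apply: idealMr.
- by exists J => x; apply/idP/idP => /JP.
Qed.

Lemma localization_is_local : exists m : ideal (localization P), local_ring_at m.
Proof.
have [J JP] := prime_is_ideal.
have [||m mP] := @ideal_comprehension (localization P) (fun y => y \in ideal_loc P J).
- exact: ideal_zero.
- by move=> a x y xJ yJ; apply: ideal_add => //; apply: ideal_mulr.
exists m; split=> [|y ym].
  apply/negP => /mP; rewrite -(rmorph1 phi) => /to_loc_in_ideal_loc[t tP].
  by rewrite mulr1 JP (negPf tP).
have [x [s [sP e]]] := loc_fracP y.
have [|v ve] := @to_loc_inv x; last by exists (v * phi s); rewrite -mulrA e.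
by apply: contra ym => xP; apply/mP/ideal_locP; exists x, s; rewrite JP.
Qed.

End LocalizedIdeals.

(** Otherwise the ideal of all t with t * x in J is proper, so it is contained in
    some prime P, and no denominator outside P can bring x into J. *)
Lemma mem_ideal_local (R : comNzRingType) (J : ideal R) x :
  (forall P : prime_idealr R, to_loc P x \in ideal_loc P J) -> x \in J.
Proof.
move=> xJ; apply: contrapT => /negP xJ'.
have [||K KP] := @ideal_comprehension R (fun t => t * x \in J).
- by rewrite mul0r; apply: ideal_zero.
- move=> a y z yP zP; rewrite mulrDl -mulrA.
  by apply: ideal_add => //; apply: ideal_mulr.
have [|P PK] := @exists_prime_above R K.
  by apply/negP => /KP; rewrite mul1r (negPf xJ').
by have /to_loc_in_ideal_loc[t /negP tP /KP /PK] := xJ P.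
Qed.
(** * Finite presentations over a Noetherian ring *)

Section Presentations.
Variable R : comNzRingType.
Hypothesis noethR : noetherian R.

(** Submodules of a finite free module are finitely generated: lift generators of
    the ideal of first coordinates, and add generators of the submodule of
    vectors whose first coordinate is zero. *)
Lemma noetherian_row_submodule r (K : 'rV[R]_r -> Prop) :
  K 0 -> (forall a u v, K u -> K v -> K (a *: u + v)) ->
  exists m (A : 'M[R]_(m, r)), forall u, K u <-> exists v, u = v *m A.
Proof.
elim: r K => [|r IHr]; last rewrite -[r.+1]/(1 + r)%N; move=> K K0 KD.
  exists 0%N, 0 => u; split=> [_|[v ->]]; last by rewrite mulmx0.
  by exists 0; rewrite mul0mx; apply/rowP => -[].
have [||L LP] := @ideal_comprehension R
    (fun x => exists u : 'rV_r, K (row_mx x%:M u)).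
- by exists 0; rewrite raddf0 row_mx0.
- move=> a x y [u Ku] [v Kv]; exists (a *: u + v).
  rewrite raddfD /= -scale_scalar_mx -add_row_mx -scale_row_mx.
  exact: KD.
have [s Ls] := noethR L.
have /choice[w Kw] : forall i : 'I_(size s), exists w : 'rV_r, K (row_mx (s`_i)%:M w).
  by move=> i; apply/LP; rewrite Ls; apply: mem_ideal_gen; apply: mem_nth.
pose W : 'M[R]_(size s, 1 + r) := \matrix_i row_mx (s`_i)%:M (w i).
have KW c : K (c *m W).
  rewrite mulmx_sum_row.
  elim/big_ind: _ => // [u v Ku Kv|i _]; first by rewrite -[u]scale1r; apply: KD.
  by rewrite rowK -[_ *: _]addr0; apply: KD.
have [||m [A AP]] := IHr (fun u => K (row_mx (0 : 'M_1) u)).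
- by rewrite row_mx0.
- move=> a u v Ku Kv; have := KD a _ _ Ku Kv.
  by rewrite scale_row_mx add_row_mx scaler0 addr0.
exists (size s + m)%N, (col_mx W (row_mx (0 : 'M_(m, 1)) A)) => u; split; last first.
  move=> [v ->]; rewrite -[v]hsubmxK mul_row_col mul_mx_row mulmx0.
  rewrite -[_ *m W]scale1r; apply: KD => //.
  by apply/AP; exists (rsubmx v).
rewrite -[u](@hsubmxK _ _ 1 r) [lsubmx _]mx11_scalar; set x := lsubmx _ _ _ => Ku.
have /LP : exists u : 'rV_r, K (row_mx x%:M u) by eexists; apply: Ku.
rewrite Ls set_seq_range => /ideal_gen_rangeP[c xc].
pose cv := \row_i c i.
have lW : lsubmx (cv *m W) = x%:M.
  apply/rowP => i; rewrite ord1 !mxE xc mulr1n; apply: eq_bigr => k _.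
  by rewrite !mxE (unsplitK (inl _)) mxE mulr1n.
have := KD (-1) _ _ (KW cv) Ku.
rewrite -{1}[cv *m W]hsubmxK lW scale_row_mx add_row_mx scaleN1r addNr.
move=> /AP[v ev]; exists (row_mx cv v).
rewrite mul_row_col mul_mx_row mulmx0 -ev -[cv *m W in RHS]hsubmxK lW.
rewrite add_row_mx addr0.
by rewrite row_mxKr scaleN1r addrA addrN add0r.
Qed.

Lemma noetherian_presentation (I : ideal R) :
  inhabited (presentation (ideal_module I)).
Proof.
have [s Is] := noethR I.
have hI (u : 'rV[R]_(size s)) : (\sum_i u 0 i * s`_i : R^o) \in I.
  apply: ideal_sum => i _; apply: ideal_mulr.
  by rewrite Is; apply: mem_ideal_gen; apply: mem_nth.
pose h (u : 'rV[R]_(size s)) : ideal_module I := Sub (\sum_i u 0 i * s`_i : R^o) (hI u).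
have hlin : linear h.
  move=> a u v; apply: val_inj; rewrite linearP !SubK /=.
  rewrite [X in _ = X + _]mulr_sumr -big_split; apply: eq_bigr => i _.
  by rewrite !mxE mulrDl mulrA.
pose H : {linear 'rV[R]_(size s) -> ideal_module I} :=
  HB.pack h (GRing.isLinear.Build R 'rV[R]_(size s) (ideal_module I) *:%R h hlin).
have [||m [A AP]] := @noetherian_row_submodule _ (fun u => H u = 0).
- exact: linear0.
- by move=> a u v Hu Hv; rewrite linearP Hu Hv scaler0 addr0.
constructor; apply: (@Presentation _ _ _ _ A H) => // x.
have : sval x \in ideal_gen [set` s] by rewrite -Is; apply: valP.
rewrite set_seq_range => /ideal_gen_rangeP[c xc].
exists (\row_i c i); apply: val_inj; rewrite SubK [RHS]xc.
by apply: eq_bigr => i _; rewrite mxE.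
Qed.

Lemma presentation_generators (I : ideal R) (p : presentation (ideal_module I)) :
  exists g : 'I_(pres_rank p) -> R,
    I =i ideal_gen (range g) /\
    forall u : 'rV[R]_(pres_rank p),
      \sum_i u 0 i * g i = 0 <-> exists v, u = v *m pres_mx p.
Proof.
pose g i : R := val (pres_map p (delta_mx 0 i)).
have pE u : val (pres_map p u) = \sum_i u 0 i * g i.
  rewrite {1}[u]row_sum_delta linear_sum raddf_sum; apply: eq_bigr => i _ /=.
  by rewrite linearZ.
exists g; split=> [x|u]; last first.
  rewrite -pres_exact -pE; split=> [e|->]; last exact: raddf0.
  by apply: val_inj; rewrite e raddf0.
apply/idP/idP; last by apply: ideal_gen_least => _ [i _ <-]; apply: valP.
move=> xI; have [u eu] := pres_surj p (Sub x xI).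
apply/ideal_gen_rangeP; exists (fun i => u 0 i).
by rewrite -pE eu SubK.
Qed.

End Presentations.
(** * Minimal generators over a local ring *)

Section LocalGenerators.
Variables (S : comNzRingType) (m : ideal S).
Hypothesis Sloc : local_ring_at m.

(** For a subset D minimal for inclusion, a relation with a coefficient outside
    m, that is invertible, would make the corresponding generator redundant. *)
Lemma minimal_generating_subset r (g : 'I_r -> S) :
  exists D : {set 'I_r},
    (forall i, g i \in ideal_gen (range (fun l : 'I_#|D| => g (enum_val l)))) /\
    forall c : 'I_#|D| -> S, \sum_l c l * g (enum_val l) = 0 -> forall l, c l \in m.
Proof.
pose gens (D : {set 'I_r}) : set S := [set g i | i in [set` D]].
pose generating D := `[< forall i, g i \in ideal_gen (gens D) >].
have genT : generating [set: 'I_r]%SET.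
  by apply/asboolP => i; apply: mem_ideal_gen; exists i => //=; rewrite inE.
have [D /minsetP[/asboolP Dgen Dmin] _] := minset_exists (P := generating) genT.
have gensE : gens D = range (fun l : 'I_#|D| => g (enum_val l)).
  apply/seteqP; split=> _ [i iD <-]; last first.
    by exists (enum_val i) => //=; apply: enum_valP.
  by exists (enum_rank_in iD i) => //; rewrite enum_rankK_in.
exists D; split=> [i|c c0 l]; first by rewrite -gensE.
apply: contrapT => /negP /Sloc.2[v vc].
suff /asboolP genD' : generating (D :\ enum_val l)%SET.
  have /setP/(_ (enum_val l)) := Dmin _ (asboolT genD') (subD1set _ _).
  by rewrite !inE eqxx enum_valP.
apply/asboolP => i; move: (g i) (Dgen i); apply: ideal_gen_least => _ [k kD <-].
have mem k' : k' \in (D :\ enum_val l)%SET ->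
    g k' \in ideal_gen (gens (D :\ enum_val l)%SET).
  by move=> k'D; apply: mem_ideal_gen; exists k'.
have [->|nek] := eqVneq k (enum_val l); last by apply: mem; rewrite !inE nek.
move: c0; rewrite (bigD1 l) //= => /eqP; rewrite addr_eq0 => /eqP el.
rewrite -[g _]mul1r -vc -mulrA el -mulN1r; do 2!apply: ideal_mulr.
apply: ideal_sum => l' nel; apply/ideal_mulr/mem.
by rewrite !inE enum_valP andbT (inj_eq enum_val_inj).
Qed.

(** Express each family through the other, by matrices X and Y.  The rows of
    X *m Y - 1 are relations of a, so det (X *m Y) is 1 modulo m; it would be 0 if
    X had fewer columns than rows. *)
Lemma minimal_generators_card d k (a : 'I_d -> S) (b : 'I_k -> S) :
  (forall c : 'I_d -> S, \sum_l c l * a l = 0 -> forall l, c l \in m) ->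
  (forall l, a l \in ideal_gen (range b)) ->
  (forall i, b i \in ideal_gen (range a)) -> (d <= k)%N.
Proof.
move=> amin ab ba; rewrite leqNgt; apply/negP => ltkd.
have /choice[Phi PhiE] : forall l, exists u : 'I_k -> S, a l = \sum_i u i * b i.
  by move=> l; apply/ideal_gen_rangeP.
have /choice[Psi PsiE] : forall i, exists u : 'I_d -> S, b i = \sum_l u l * a l.
  by move=> i; apply/ideal_gen_rangeP.
pose X := \matrix_(l, i) Phi l i; pose Y := \matrix_(i, l) Psi i l.
have XY l l' : (X *m Y) l l' - (1%:M : 'M_d) l l' \in m.
  apply: (amin (fun l' => (X *m Y) l l' - (1%:M : 'M_d) l l')).
  transitivity (\sum_l' (X *m Y) l l' * a l' - a l).
    rewrite [X in _ - X](_ : _ = \sum_l' (1%:M : 'M_d) l l' * a l').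
      by rewrite -sumrB; apply: eq_bigr => i _; rewrite mulrBl.
    rewrite (bigD1 l) //= mxE eqxx mul1r big1 ?addr0 // => i nei.
    by rewrite mxE eq_sym (negPf nei) mul0r.
  apply/eqP; rewrite subr_eq0 PhiE; apply/eqP.
  under eq_bigr => i _ do rewrite mxE mulr_suml.
  rewrite exchange_big; apply: eq_bigr => i _; rewrite PsiE mulr_sumr.
  by apply: eq_bigr => l'' _; rewrite !mxE mulrA.
have := det_congr XY; rewrite det_mulmx_small // det1 sub0r => /(ideal_mulr (-1)).
by rewrite mulrNN mulr1; apply/negP; apply: Sloc.1.
Qed.

End LocalGenerators.

(** * Minors of a matrix of relations *)

Section MinorsOfRelations.
Variables (S : comNzRingType) (r n : nat) (g : 'I_r -> S) (A : 'M[S]_(n, r)).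
Hypothesis Aexact : forall u : 'rV[S]_r,
  \sum_y u 0 y * g y = 0 <-> exists v, u = v *m A.
Variable D : {set 'I_r}.
Local Notation h := (enum_val : 'I_#|D| -> 'I_r).
Local Notation c := (enum_val : 'I_#|~: D| -> 'I_r).
Hypothesis Dgen : forall y, g y \in ideal_gen (range (fun l : 'I_#|D| => g (h l))).

Let c_neq_h i l : (c i == h l) = false.
Proof.
by apply/negP => /eqP e; have := enum_valP i; rewrite /= inE e enum_valP.
Qed.

Let sum_delta y0 : \sum_y (y == y0)%:R * g y = g y0.
Proof.
rewrite (bigD1 y0) //= eqxx mul1r big1 ?addr0 // => y /negPf->.
by rewrite mul0r.
Qed.

Lemma syzygy_matrix_factors k (B : 'M[S]_(k, r)) :
  (forall i, \sum_y B i y * g y = 0) -> exists C, B = C *m A.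
Proof.
move=> B0; have /choice[C CE] : forall i, exists v, row i B = v *m A.
  move=> i; apply/Aexact; rewrite -[RHS](B0 i).
  by apply: eq_bigr => y _; rewrite mxE.
exists (\matrix_i C i); apply/row_matrixP => i.
by rewrite row_mul rowK CE.
Qed.

(** The relations that express the generators outside D through those in D. *)
Lemma elimination_matrix : exists (Theta : 'I_#|~: D| -> 'I_#|D| -> S)
    (T : 'M[S]_(#|~: D|, r)),
  [/\ forall i, g (c i) = \sum_l Theta i l * g (h l),
      forall i, \sum_y T i y * g y = 0,
      forall i l, T i (h l) = - Theta i l
    & forall i i', T i (c i') = (i == i')%:R].
Proof.
have /choice[Theta ThetaE] : forall i, exists u : 'I_#|D| -> S,
    g (c i) = \sum_l u l * g (h l).
  by move=> i; apply/ideal_gen_rangeP.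
exists Theta, (\matrix_(i, y) ((y == c i)%:R - \sum_l Theta i l * (y == h l)%:R)).
split=> [//|i|i l|i i'].
- under eq_bigr => y _ do rewrite mxE mulrBl mulr_suml.
  rewrite sumrB sum_delta exchange_big ThetaE; apply/eqP.
  rewrite subr_eq0; apply/eqP/eq_bigr => l _.
  by rewrite -[in LHS]sum_delta mulr_sumr; apply: eq_bigr => y _; rewrite mulrA.
- rewrite mxE eq_sym c_neq_h sub0r (bigD1 l) //= eqxx mulr1 big1 ?addr0 // => l' nel.
  by rewrite (inj_eq enum_val_inj) eq_sym (negPf nel) mulr0.
- rewrite mxE (inj_eq enum_val_inj) eq_sym big1 ?subr0 // => l _.
  by rewrite c_neq_h mulr0.
Qed.

Lemma minor_ideal_unit t : (t <= #|~: D|)%N -> 1 \in minor_ideal t A.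
Proof.
move=> letq; have [Theta [T [_ T0 _ Tc]]] := elimination_matrix.
have [C TE] := syzygy_matrix_factors T0.
have <- : \det (mxsub (widen_ord letq) (c \o widen_ord letq) (C *m A)) = 1.
  rewrite -TE -[RHS](det1 S t); congr (\det _); apply/matrixP => i k.
  by rewrite !mxE Tc.
exact: minor_mulmx_in_minor_ideal.
Qed.

(** Place the Koszul relation of the generators k and l above the elimination
    matrix: in the columns l and ~: D the resulting matrix is lower triangular,
    with diagonal g_k, 1, ..., 1. *)
Lemma generators_in_minor_ideal k : (2 <= #|D|)%N ->
  g (h k) \in minor_ideal (1 + #|~: D|) A.
Proof.
move=> D2; have [Theta [T [_ T0 _ Tc]]] := elimination_matrix.
have [l nel] : exists l : 'I_#|D|, l != k.
  have [k0|k0] := eqVneq (k : nat) 0%N.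
    by exists (Ordinal D2); rewrite -val_eqE /= k0.
  by exists (Ordinal (ltnW D2)); rewrite -val_eqE /= eq_sym.
pose w : 'rV_r := \row_y ((y == h l)%:R * g (h k) - (y == h k)%:R * g (h l)).
have w0 : \sum_y w 0 y * g y = 0.
  under eq_bigr => y _ do rewrite mxE mulrBl mulrAC [X in _ - X]mulrAC.
  by rewrite sumrB -!mulr_suml !sum_delta mulrC subrr.
have [|C BE] := @syzygy_matrix_factors _ (col_mx w T).
  move=> i; case: (splitP i) => i' ei.
    have -> : i = lshift _ i' by apply: val_inj.
    by rewrite -[RHS]w0; apply: eq_bigr => y _; rewrite (col_mxEu w T) ord1.
  have -> : i = rshift 1 i' by apply: val_inj.
  by rewrite -[RHS](T0 i'); apply: eq_bigr => y _; rewrite col_mxEd.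
pose cols (i : 'I_(1 + #|~: D|)) := if split i is inr i' then c i' else h l.
have colsr i' : cols (rshift 1 i') = c i' by rewrite /cols (unsplitK (inr _)).
have colsl i' : cols (lshift _ i') = h l by rewrite /cols (unsplitK (inl _)).
have <- : \det (mxsub id cols (C *m A)) = g (h k).
  rewrite -BE -[mxsub _ _ _](@submxK _ 1 _ 1).
  have -> : ursubmx (mxsub id cols (col_mx w T) : 'M_(1 + #|~: D|)) = 0.
    apply/matrixP => i i'; rewrite 3!mxE [RHS]mxE colsr col_mxEu mxE !c_neq_h.
    by rewrite !mul0r subr0.
  rewrite det_lblock det_mx11 3!mxE colsl col_mxEu mxE eqxx mul1r.
  rewrite (inj_eq enum_val_inj) (negPf nel) mul0r subr0.
  rewrite (_ : drsubmx _ = 1%:M) ?det1 ?mulr1 //.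
  by apply/matrixP => i i'; rewrite 3!mxE colsr col_mxEd Tc !mxE.
exact: minor_mulmx_in_minor_ideal.
Qed.

(** Subtracting from a row of A the combination of elimination relations with the
    same entries outside D leaves a relation supported on D, whose entries lie in
    J.  So A is congruent to a product through #|~: D| columns. *)
Lemma minors_in_ideal (J : ideal S) (f : 'I_(1 + #|~: D|) -> 'I_n)
    (f' : 'I_(1 + #|~: D|) -> 'I_r) :
  (forall v : 'I_#|D| -> S, \sum_l v l * g (h l) = 0 -> forall l, v l \in J) ->
  \det (mxsub f f' A) \in J.
Proof.
move=> Jsyz; have [Theta [T [ThetaE _ Th Tc]]] := elimination_matrix.
have congrT x y : A x y - (colsub c A *m T) x y \in J.
  have [yD|yD] := boolP (y \in D); last first.
    have yD' : y \in (~: D)%SET by rewrite inE.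
    have -> : y = c (enum_rank_in yD' y) by rewrite /= enum_rankK_in.
    set i := enum_rank_in _ _.
    rewrite mxE (bigD1 i) //= mxE Tc eqxx mulr1 big1 ?addr0 ?subrr ?ideal_zero //.
    by move=> i' nei; rewrite mxE Tc (negPf nei) mulr0.
  have -> : y = h (enum_rank_in yD y) by rewrite /= enum_rankK_in.
  move: (enum_rank_in _ _) => {yD} l.
  apply: (Jsyz (fun l => A x (h l) - (colsub c A *m T) x (h l))).
  have Ax0 : \sum_y A x y * g y = 0.
    have [_ h0] := Aexact (row x A).
    rewrite -[RHS]h0; last by exists (delta_mx 0 x); rewrite -rowE.
    by apply: eq_bigr => y' _; rewrite mxE.
  rewrite -[RHS]Ax0 [RHS](bigID (mem D)) /= [X in _ = X + _]big_enum_val /=.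
  have notD y' : (y' \notin D) = (y' \in (~: D)%SET) by rewrite inE.
  rewrite [X in _ = _ + X](eq_bigl _ _ notD) [X in _ = _ + X]big_enum_val /=.
  under eq_bigr => l' _ do rewrite mulrBl.
  rewrite sumrB; congr (_ + _).

  under [in RHS]eq_bigr => i _ do rewrite ThetaE mulr_sumr.
  rewrite exchange_big -sumrN; apply: eq_bigr => l' _ /=.
  rewrite mxE mulr_suml -sumrN; apply: eq_bigr => i _.
  by rewrite mxE Th mulrN mulNr opprK mulrA.
have : \det (mxsub f f' A) - \det (mxsub f f' (colsub c A *m T)) \in J.
  apply: det_congr => x y.
  by rewrite [mxsub _ _ A _ _]mxE [mxsub _ _ (_ *m _) _ _]mxE; apply: congrT.
by rewrite mxsub_mul det_mulmx_small ?subr0.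
Qed.

End MinorsOfRelations.
(** * Comparing the ideal with its Fitting ideal *)

Section FittingOfPresentation.
Variables (R : comNzRingType) (I : ideal R) (r n : nat).
Variables (g : 'I_r -> R) (A : 'M[R]_(n, r)).
Hypothesis Igen : I =i ideal_gen (range g).
Hypothesis Aexact : forall u : 'rV[R]_r,
  \sum_y u 0 y * g y = 0 <-> exists v, u = v *m A.

Section AtPrime.
Variable P : prime_idealr R.
Local Notation phi := (to_loc P).

Lemma common_denominator k (u : 'I_k -> localization P) :
  exists s (u' : 'I_k -> R), s \notin P /\ forall i, phi s * u i = phi (u' i).
Proof.
have /choice[x /choice[s xs]] := fun i => loc_fracP (u i).
exists (\prod_i s i), (fun i => (\prod_(l < k | l != i) s l) * x i); split.
  elim/big_ind: _ => [|a b|i _]; [by rewrite idealr1 | exact: mul_notin_prime |].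
  by have [] := xs i.
by move=> i; rewrite (bigD1 i) //= !rmorphM mulrAC /= (xs i).2 mulrC.
Qed.

(** Clear denominators to bring a relation back to R. *)
Lemma localized_exact (u : 'rV[localization P]_r) :
  \sum_y u 0 y * phi (g y) = 0 <-> exists v, u = v *m map_mx phi A.
Proof.
split; last first.
  move=> [v ->]; under eq_bigr => y _ do rewrite mxE mulr_suml.
  rewrite exchange_big big1 // => i _ /=.
  have [_ A0] := Aexact (row i A).
  have {}A0 : \sum_y A i y * g y = 0.
    rewrite -[RHS]A0; last by exists (delta_mx 0 i); rewrite -rowE.
    by apply: eq_bigr => y _; rewrite mxE.
  under eq_bigr => y _ do rewrite mxE -mulrA -rmorphM.
  by rewrite -mulr_sumr -rmorph_sum A0 rmorph0 mulr0.
have [s [u' [sP eu]]] := common_denominator (u 0).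
move=> u0; have : phi (\sum_y u' y * g y) = phi 0.
  transitivity (phi s * \sum_y u 0 y * phi (g y)); last by rewrite u0 mulr0 rmorph0.
  rewrite rmorph_sum mulr_sumr.
  by apply: eq_bigr => y _; rewrite rmorphM mulrA eu.
move=> /to_loc_eqP[t tP]; rewrite mulr0 mulr_sumr => tu0.
have [|w ew] := (Aexact (\row_y (t * u' y))).1.
  by rewrite -[RHS]tu0; apply: eq_bigr => y _; rewrite mxE mulrA.
have [v ev] := to_loc_inv (mul_notin_prime tP sP).
exists (v *: map_mx phi w); rewrite -scalemxAl -map_mxM -ew.
apply/rowP => y; rewrite !mxE rmorphM /= -eu mulrA -[LHS]mul1r -ev rmorphM /=.
by ring.
Qed.

Lemma ideal_loc_range : ideal_loc P I =i ideal_gen (range (phi \o g)).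
Proof.
move=> y; apply/idP/idP; move: y; apply: ideal_gen_least => _ [x xI <-].
  move: xI; rewrite /= Igen => /ideal_gen_rangeP[u ->].
  apply/ideal_gen_rangeP; exists (fun i => phi (u i)).
  by rewrite rmorph_sum; apply: eq_bigr => i _; rewrite rmorphM.
apply: mem_ideal_gen; exists (g x) => //=.
by rewrite Igen; apply: mem_ideal_gen; exists x.
Qed.

Lemma minor_ideal_localized t (J : ideal R) :
  {subset minor_ideal t A <= J} ->
  {subset minor_ideal t (map_mx phi A) <= ideal_loc P J}.
Proof.
move=> AJ; apply: ideal_gen_least => _ [f [f' [fi fi' ->]]].
rewrite -map_mxsub det_map_mx; apply: mem_ideal_gen.
exists (\det (mxsub f f' A)) => //=; apply: AJ.
by apply: mem_ideal_gen; exists f, f'.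
Qed.

Variables (j : nat) (f : seq R).
Hypotheses (j2 : (2 <= j)%N) (szf : size f = j) (freg : weakly_regular f).
Hypothesis fI : {subset f <= I}.
Hypothesis Imu : {subset I <= P} -> has_mu (ideal_loc P I) j.

(** The two alternatives are whether P contains I or not.  In the first one,
    minimality gives #|D| <= j and the minimal number of generators gives the
    converse; in the second one, D is compared with the generating family 1. *)
Lemma fitting_local_data : exists D : {set 'I_r},
  (forall y, phi (g y) \in
     ideal_gen (range (fun l : 'I_#|D| => phi (g (enum_val l))))) /\
  ([/\ #|D| = j, (r - (j - 1) = 1 + #|~: D|)%N &
     forall v : 'I_#|D| -> localization P,
       \sum_l v l * phi (g (enum_val l)) = 0 ->
       forall l, v l \in ideal_loc P I] \/
   1 \in ideal_loc P I /\ (r - (j - 1) <= #|~: D|)%N).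
Proof.
have [m mloc] := localization_is_local P.
have [D [Dgen Dmin]] := minimal_generating_subset mloc (phi \o g).
exists D; split=> //.
have Dloc : ideal_loc P I =i
    ideal_gen (range (fun l : 'I_#|D| => phi (g (enum_val l)))).
  move=> y; rewrite ideal_loc_range.
  apply/idP/idP; move: y; apply: ideal_gen_least => _ [i _ <-]; first exact: Dgen.
  by apply: mem_ideal_gen; exists (enum_val i).
have Dr : (#|D| + #|~: D| = r)%N by rewrite cardsC card_ord.
have [IP|/existsNP[x /not_implyP[xI /negP xP]]] := pselect {subset I <= P}.
  left; have [[s szs Is] Imin] := Imu IP.
  have Dj : #|D| = j.
    apply/eqP; rewrite eqn_leq -{1}szs; apply/andP; split.
      apply: (minimal_generators_card mloc (b := fun i => s`_i) Dmin) => [l|i].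
        rewrite -set_seq_range -Is Dloc; apply: mem_ideal_gen.
        by exists l.
      by rewrite -Dloc Is set_seq_range; apply: mem_ideal_gen; exists i.
    have := Imin [seq phi (g y) | y <- enum D]; rewrite size_map -cardE; apply.
    move=> y; rewrite Dloc; congr (y \in ideal_gen _).
    apply/seteqP; split=> z /=.
      by move=> [l _ <-]; apply: map_f; rewrite mem_enum enum_valP.
    move=> /mapP[i]; rewrite mem_enum => iD ->.
    by exists (enum_rank_in iD i) => //; rewrite enum_rankK_in.
  split=> //.
    rewrite -[X in (X - _)%N]Dr Dj; case: j j2 => [//|j' _].
    by rewrite subn1 addSn -addnS addKn.
  move=> v v0 l; rewrite Dloc; move: l.
  have freg' : weakly_regular [seq phi y | y <- f] := weakly_regular_loc freg.
  apply: (syzygy_coefs_in_ideal freg') => //.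
    by rewrite size_map szf Dj.
  move=> _ /mapP[y yf ->]; rewrite -Dloc.
  by apply: mem_ideal_gen; exists y => //=; apply: fI.
right; have one_in : 1 \in ideal_loc P I.
  have [y yI /to_loc_inv[v vy]] : exists2 y : R, y \in I & y \notin P by exists x.
  suff : v * phi y \in ideal_loc P I by rewrite vy.
  by apply/ideal_mulr/mem_ideal_gen; exists y.
split=> //; rewrite -[X in (X - _)%N]Dr leq_subLR leq_add2r.
apply: (@leq_trans 1); last by case: j j2 => [|[]].
apply: (minimal_generators_card mloc (b := fun=> 1) Dmin) => [l|_].
  apply/ideal_gen_rangeP; exists (fun=> phi (g (enum_val l))).
  by rewrite big_ord1 mulr1.
by rewrite -Dloc.
Qed.

Lemma fitting_minors_in_ideal f' f'' :
  to_loc P (\det (mxsub f' f'' A : 'M_(r - (j - 1)))) \in ideal_loc P I.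
Proof.
have [D [Dgen [[Dj t_eq Dsyz]|[one_in _]]]] := fitting_local_data; last first.
  by rewrite -[to_loc _ _]mulr1; apply: ideal_mulr.
rewrite -det_map_mx map_mxsub; move: f' f''; rewrite t_eq => f' f''.
exact: (minors_in_ideal localized_exact Dgen _ _ Dsyz).
Qed.

Lemma ideal_in_fitting_minors x (J : ideal R) : x \in I ->
  {subset minor_ideal (r - (j - 1)) A <= J} -> to_loc P x \in ideal_loc P J.
Proof.
move=> xI /minor_ideal_localized AJ.
have [D [Dgen [[Dj t_eq Dsyz]|[one_in letq]]]] := fitting_local_data; last first.
  rewrite -[to_loc _ _]mulr1; apply: ideal_mulr; apply: AJ.
  exact: (minor_ideal_unit localized_exact Dgen).
have : phi x \in ideal_loc P I by apply: mem_ideal_gen; exists x.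
rewrite ideal_loc_range; move: (phi x); apply: ideal_gen_least => _ [y _ <-] /=.
move: (phi (g y)) (Dgen y); apply: ideal_gen_least => _ [l _ <-].
apply: AJ; rewrite t_eq; apply: (generators_in_minor_ideal localized_exact Dgen).
by rewrite Dj.
Qed.

End AtPrime.

End FittingOfPresentation.

Theorem proposition1p5 (R : comNzRingType) (j : nat) (I : ideal R) :
  noetherian R -> cohen_macaulay R -> (2 <= j)%N ->
  @has_grade R I j ->
  (forall P : prime_idealr R, {subset I <= P} -> has_mu (ideal_loc P I) j) ->
  fitting (j - 1) (ideal_module I) =i I.
Proof.
move=> noethR _ j2 [f [szf fI [_ freg] _]] Imu x.
rewrite /fitting; case: pselect => [h|]; last by case; apply: noetherian_presentation.
set p := inhabited_witness h; have [g [Igen Aexact]] := presentation_generators p.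
apply/idP/idP.
  move: x; apply: ideal_gen_least => _ [f' [f'' [_ _ ->]]].
  apply: mem_ideal_local => P.
  exact: (fitting_minors_in_ideal Igen Aexact j2 szf freg fI (Imu P)).
move=> xI; have [||J JE] := @ideal_comprehension R
    (fun y => y \in minor_ideal (pres_rank p - (j - 1)) (pres_mx p)).
- exact: ideal_zero.
- by move=> a y z yJ zJ; apply: ideal_add => //; apply: ideal_mulr.
apply/JE; apply: (@mem_ideal_local R) => P.
by apply: (ideal_in_fitting_minors Igen Aexact j2 szf freg fI (Imu P) xI) => y /JE.
Qed.
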